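(* For $\Gamma\in G(n,\tfrac12)$, the right-angled Coxeter group $W_\Gamma$ is asymptotically almost surely strongly algebraically thick; equivalently $\mathbb P(\Gamma\in\mathcal T)\to1$ as $n\to\infty$.
   Context: $G(n,p)$: random simplicial graphs on $n$ labelled vertices with each edge present independently with probability $p$. $W_\Gamma$ is the right-angled Coxeter group of $\Gamma$. $\mathcal T$ is the smallest class of finite simplicial graphs containing $K_{2,2}$, closed under adding a new vertex adjacent exactly to the vertices of an induced subgraph which is not a clique, and closed under gluing two members along a common induced subgraph which is not a clique (optionally adding edges between the two non-shared parts). A right-angled Coxeter group $W_\Gamma$ is strongly algebraically thick iff $\Gamma\in\mathcal T$; strongly algebraically thick means: order $0$ = wide (no cut points in asymptotic cones), order $\le n$ = algebraic network (finite collection of subgroups of order $\le n-1$, generating a finite-index subgroup, chained through infinite intersections with path-connected $C$-neighborhoods, each quasiconvex via $(C,C)$-quasigeodesics). *)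

(* Defs.v *)
From HB Require Import structures.
From mathcomp Require Import all_boot all_order all_algebra.
Set Implicit Arguments. Unset Strict Implicit. Unset Printing Implicit Defensive.

Notation graph n := {ffun 'I_n * 'I_n -> bool}.

Definition simpleg n (g : graph n) : bool :=
  [forall x, ~~ g (x, x)] && [forall x, [forall y, g (x, y) == g (y, x)]].

Definition clique n (g : graph n) (A : {set 'I_n}) : bool :=
  [forall x in A, [forall y in A, (x != y) ==> g (x, y)]].

(* K_{2,2} = the 4-cycle 0-1-2-3-0 (parts {0,2} and {1,3}). *)
Definition K22 : graph 4 :=
  [ffun p => let a := val p.1 in let b := val p.2 in
             (a.+1 %% 4 == b) || (b.+1 %% 4 == a)].

Definition cone n (g : graph n) (A : {set 'I_n}) : graph n.+1 :=
  [ffun p => match unlift ord_max p.1, unlift ord_max p.2 with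
             | Some x, Some y => g (x, y)
             | Some x, None => x \in A
             | None, Some y => y \in A
             | None, None => false
             end].

Inductive inT : forall n, graph n -> Prop :=
| inT_K22 : inT K22
| inT_iso n (g : graph n) (s : 'I_n -> 'I_n) :
    injective s -> inT g -> inT [ffun p => g (s p.1, s p.2)]
| inT_cone n (g : graph n) (A : {set 'I_n}) :
    inT g -> ~~ clique g A -> inT (cone g A)
| inT_glue m (h : graph m) (A B C : {set 'I_m})
    k1 (g1 : graph k1) (f1 : 'I_k1 -> 'I_m)
    k2 (g2 : graph k2) (f2 : 'I_k2 -> 'I_m) :
    inT g1 -> inT g2 -> simpleg h ->
    [disjoint A & B] -> [disjoint A & C] -> [disjoint B & C] ->
    A :|: B :|: C = setT ->
    injective f1 -> f1 @: setT = A :|: C ->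
    (forall x y, g1 (x, y) = h (f1 x, f1 y)) ->
    injective f2 -> f2 @: setT = B :|: C ->
    (forall x y, g2 (x, y) = h (f2 x, f2 y)) ->
    ~~ clique h C ->
    inT h.

(* The simple graphs on n labelled vertices: the sample space of G(n,1/2),
   on which G(n,1/2) is the uniform distribution. *)
Definition simple_graphs n : {set graph n} := [set g : graph n | simpleg g].

(* Main.v *)
(* Asymptotically almost surely any three vertices a, b, v have two non-adjacent
   common neighbours: in disjoint pairs {c, d} of further vertices the seven
   relevant edges are independent, so a triple fails with probability at most
   (127/128)^j for j disjoint pairs, which beats the n^3 triples. In such a
   graph, take a non-edge ab with non-adjacent common neighbours c, d: then acbd
   is an induced 4-cycle, every common neighbour of a and b can be coned on
   (its neighbourhood contains the non-edge ab), and afterwards so can every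
   remaining vertex v (its neighbourhood contains a non-edge among the common
   neighbours of a, b, v). Gluing is never needed. *)

Require Import Defs.
From HB Require Import structures.
From mathcomp Require Import all_boot all_order all_algebra.
Import Order.TTheory GRing.Theory Num.Theory.
Local Open Scope ring_scope.

(** * Building a graph inside the class along a growing set of its vertices *)

Section InducedSubgraphs.

Local Open Scope nat_scope.
Context {n : nat} (g : graph n).

(** Vertex sets of graphs are ordinals, so the subgraph induced on [S] is represented by any
    relabelled copy [h] with an embedding [f] onto [S]. *)
Definition ind_inT (S : {set 'I_n}) : Prop :=
  exists k (h : graph k) (f : 'I_k -> 'I_n),
    [/\ injective f, f @: setT = S, forall x y, h (x, y) = g (f x, f y)
      & inT h].

Definition nonadjacent_common_nbrs (D : seq 'I_n) (c d : 'I_n) : bool :=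
  [&& c != d, ~~ g (c, d), all (fun x => g (x, c)) D
    & all (fun x => g (x, d)) D].

Lemma ind_inT_setT : ind_inT setT -> inT g.
Proof.
move=> [k [h [f [injf imf hE hT]]]].
have kn : k = n.
  by rewrite -[k]card_ord -[RHS]card_ord -!cardsT -(card_imset _ injf) imf.
move: h f injf imf hE hT; rewrite kn => h f injf imf hE hT.
(* With [k = n] the embedding [f] is a permutation, and [g] is [h] relabelled by its inverse. *)
have -> : g = [ffun p => h (invF injf p.1, invF injf p.2)].
  by apply/ffunP => -[x y]; rewrite ffunE hE /= !f_invF.
by apply: inT_iso => //; apply: can_inj (f_invF injf).
Qed.

Hypothesis g_simple : simpleg g.

Lemma simpleg_irr x : g (x, x) = false.
Proof. by case/andP: g_simple => /forallP/(_ x)/negbTE. Qed.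

Lemma simpleg_sym x y : g (x, y) = g (y, x).
Proof. by case/andP: g_simple => _ /forallP/(_ x)/forallP/(_ y)/eqP. Qed.

(** Cone over the neighbours of [v] inside [S]: the non-edge [cd] shows that they do not form a
    clique. The apex [ord_max] is sent to [v]. *)
Lemma ind_inT_add (S : {set 'I_n}) v c d :
  ind_inT S -> v \notin S -> c \in S -> d \in S ->
  nonadjacent_common_nbrs [:: v] c d -> ind_inT (v |: S).
Proof.
move=> [k [h [f [injf imf hE hT]]]] vS cS dS.
rewrite /nonadjacent_common_nbrs /= !andbT => /and4P[cd ncd gvc gvd].
pose f' (x : 'I_k.+1) := if unlift ord_max x is Some y then f y else v.
pose A := [set x : 'I_k | g (v, f x)].
have fS x : f x \in S by rewrite -imf imset_f.
exists k.+1, (cone h A), f'; split.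
- move=> x y; rewrite /f'.
  case: unliftP => [x'|] ->; case: unliftP => [y'|] -> //.
  + by move/injf->.
  + by move=> fv; rewrite -fv fS in vS.
  + by move=> fv; rewrite fv fS in vS.
- apply/setP => z; rewrite !inE; apply/imsetP/orP => [[x _ ->]|].
    rewrite /f'; case: unliftP => [x'|] _; last by left.
    by right.
  case=> [/eqP ->|]; first by exists ord_max; rewrite // /f' unlift_none.
  rewrite -imf => /imsetP[x _ ->]; exists (lift ord_max x) => //.
  by rewrite /f' liftK.
- move=> x y; rewrite ffunE /= /f'.
  case: unliftP => [x'|] _; case: unliftP => [y'|] _ //.
  + by rewrite inE simpleg_sym.
  + by rewrite inE.
  + by rewrite simpleg_irr.
apply: inT_cone => //; apply/negP.
move: cS dS; rewrite -imf => /imsetP[x _ cE] /imsetP[y _ dE].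
move=> /forall_inP/(_ x); rewrite inE -cE => /(_ gvc) /forall_inP/(_ y).
rewrite inE -dE hE -cE -dE (negbTE ncd) implybF negbK => /(_ gvd) /eqP xy.
by rewrite cE dE xy eqxx in cd.
Qed.

(** Vertices of [X] are added one at a time. The witnesses lie in the initial [S], so they are still
    present at every stage. *)
Lemma ind_inT_grow (S X : {set 'I_n}) :
  ind_inT S ->
  {in X, forall v, exists c d,
     [/\ c \in S, d \in S & nonadjacent_common_nbrs [:: v] c d]} ->
  ind_inT (S :|: X).
Proof.
move=> ST SX; rewrite -(set_enum X).
have : {subset enum X <= X} by move=> x; rewrite mem_enum.
elim: (enum X) => [_|v s IHs vsX]; first by rewrite set_nil setU0.
have {IHs} sT : ind_inT (S :|: [set x in s]).
  by apply: IHs => x xs; apply: vsX; rewrite inE xs orbT.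
rewrite set_cons setUCA.
have [vS|vS] := boolP (v \in S :|: [set x in s]).
  by rewrite (setUidPr _) // sub1set.
have [|c [d [cS dS vcd]]] := SX v; first by apply: vsX; rewrite mem_head.
by apply: (ind_inT_add _ _ c d) => //; rewrite inE ?cS ?dS.
Qed.

Lemma ind_inT_K22 a c b d :
  nonadjacent_common_nbrs [:: a; b] c d -> a != b -> ~~ g (a, b) ->
  ind_inT [set a; b; c; d].
Proof.
rewrite /nonadjacent_common_nbrs /= !andbT.
move=> /and4P[cd ncd /andP[gac gbc] /andP[gad gbd]] ab nab.
have adj_neq x y : g (x, y) -> x != y.
  by apply: contraTneq => ->; rewrite simpleg_irr.
(* The order [a, c, b, d] follows the cycle 0-1-2-3 of [K22], with the non-edges [ab] and [cd] as
   diagonals. *)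
exists 4, K22, (tnth [tuple a; c; b; d]); split; last exact: inT_K22.
- apply/tuple_uniqP; rewrite /= !inE !negb_or ab (adj_neq a c) // (adj_neq a d) //.
  by rewrite eq_sym (adj_neq b c) // cd (adj_neq b d).
- apply/setP => z; rewrite !inE; apply/imsetP/idP => [[x _ ->]|].
    have := mem_tnth x [tuple a; c; b; d]; rewrite !inE.
    by case/or4P => ->; rewrite ?orbT.
  move=> zE; have : z \in [tuple a; c; b; d].
    by rewrite !inE; case/orP: zE => [/orP[/orP[]|]|] ->; rewrite ?orbT.
  by case/tnthP => i ->; exists i.
- case=> [[|[|[|[|//]]]] ?] [[|[|[|[|//]]]] ?]; rewrite ffunE !(tnth_nth a) /=;
  apply/esym; rewrite ?simpleg_irr //; do ?by apply/negbTE.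
  all: by rewrite simpleg_sym //; apply/negbTE.
Qed.

Lemma inT_of_common_nbrs :
  2 < n ->
  (forall a b v, uniq [:: a; b; v] ->
     exists c d, nonadjacent_common_nbrs [:: a; b; v] c d) ->
  inT g.
Proof.
move=> n_gt2 trip.
have n_gt0 : 0 < n by apply: ltn_trans n_gt2.
have n_gt1 : 1 < n by apply: ltn_trans n_gt2.
(* The triple 0, 1, 2 only serves to produce a non-edge [ab]. Being adjacent to both ends, [u]
   completes [a, b] to a triple of distinct vertices. *)
pose u := Ordinal n_gt0.
have [//|a [b]] := trip u (Ordinal n_gt1) (Ordinal n_gt2).
move=> /and4P[ab nab /andP[ua _] /andP[ub _]].
have abu : uniq [:: a; b; u].
  rewrite /= !inE negb_or ab /= andbT; apply/andP; split.
    by apply: contraTneq ua => ->; rewrite simpleg_irr.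
  by apply: contraTneq ub => ->; rewrite simpleg_irr.
have [c [d /and4P[cd ncd]]] := trip a b u abu.
move=> /and4P[ac bc _ _] /and4P[ad bd _ _].
have S0T : ind_inT [set a; b; c; d].
  apply: ind_inT_K22 => //.
  by rewrite /nonadjacent_common_nbrs /= cd ncd ac bc ad bd.
have S1T := ind_inT_grow _ [set v | g (a, v) && g (b, v)] S0T.
apply: ind_inT_setT.
rewrite -(setUT ([set a; b; c; d] :|: [set v | g (a, v) && g (b, v)])).
apply: ind_inT_grow.
  apply: S1T => v; rewrite inE => /andP[av bv]; exists a, b.
  rewrite !inE !eqxx /= ?orbT; split=> //.
  by rewrite /nonadjacent_common_nbrs /= ab nab !(simpleg_sym v) av bv.
(* For [v] equal to [a] or [b] there is no distinct triple to use, but [c, d] serve directly.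
   Otherwise the pair given for [a, b, v] lies among the common neighbours of [a] and [b], already
   adjoined. *)
move=> v _; have [vab|vab] := boolP (v \in [:: a; b]).
  exists c, d; rewrite !inE !eqxx ?orbT; split=> //.
  rewrite /nonadjacent_common_nbrs /= cd ncd /=.
  by move: vab; rewrite !inE => /orP[] /eqP ->; rewrite ?ac ?ad ?bc ?bd.
have [|p [q]] := trip a b v.
  move: vab; rewrite /= !inE !negb_or ab => /andP[].
  by rewrite !(eq_sym v) => -> ->.
move=> /and4P[pq npq /and4P[ap bp vp _] /and4P[aq bq vq _]].
exists p, q; rewrite !inE ap bp aq bq !orbT; split=> //.
by rewrite /nonadjacent_common_nbrs /= pq npq vp vq.
Qed.

End InducedSubgraphs.

(** * Independence of edges, expressed by counting with edge flips *)

Section EdgeFlips.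

Local Open Scope nat_scope.
Context {n : nat}.
Implicit Types (g : graph n) (P : pred (graph n)) (D : seq 'I_n).

(** Both orientations are toggled, which preserves symmetry. Invariance of a property under this
    involution plays the part of independence from the edge [xy]. *)
Definition flip (x y : 'I_n) g : graph n :=
  [ffun p => (p \in [:: (x, y); (y, x)]) (+) g p].

Lemma flipK x y : involutive (flip x y).
Proof. by move=> g; apply/ffunP => p; rewrite !ffunE addKb. Qed.

Lemma flip_edge x y g : flip x y g (x, y) = ~~ g (x, y).
Proof. by rewrite ffunE mem_head. Qed.

Lemma flip_out x y g p q :
  (p \notin [:: x; y]) || (q \notin [:: x; y]) -> flip x y g (p, q) = g (p, q).
Proof.
rewrite ffunE !inE !xpair_eqE.
by case: (p == x); case: (p == y); case: (q == x); case: (q == y).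
Qed.

Lemma flip_avoid x c g y z :
  y != c -> z != c -> flip x c g (y, z) = g (y, z).
Proof.
by move=> yc zc; rewrite ffunE !inE !xpair_eqE (negbTE yc) (negbTE zc) andbF.
Qed.

Lemma simpleg_flip x y g : x != y -> simpleg (flip x y g) = simpleg g.
Proof.
move=> xy; suff imp h : simpleg h -> simpleg (flip x y h).
  by apply/idP/idP => [/imp|/imp //]; rewrite flipK.
move=> hs; apply/andP; split.
  apply/forallP => z; rewrite ffunE !inE !xpair_eqE simpleg_irr // addbF.
  by have [->|] := eqVneq z x; rewrite ?(negbTE xy) // andbF.
apply/forallP => z; apply/forallP => w; rewrite !ffunE !inE !xpair_eqE.
by rewrite (simpleg_sym h hs w) orbC andbC [in X in _ || X]andbC.
Qed.

(** The flip is a bijection, within [P], between the graphs having the edge and those lacking it. *)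
Lemma card_edge_half P x y b :
  (forall g, P (flip x y g) = P g) ->
  #|[set g | P g && (g (x, y) == b)]| * 2 = #|[set g | P g]|.
Proof.
move=> Pflip; rewrite muln2 -addnn.
rewrite -[RHS](cardsID [set g : graph n | g (x, y) == b]).
congr (_ + _); first by apply: eq_card => g; rewrite !inE.
rewrite -(card_imset _ (inv_inj (flipK x y))); apply: eq_card => g.
rewrite -[g in LHS](flipK x y) mem_imset ?inE; last exact: inv_inj (flipK x y).
by rewrite Pflip flip_edge andbC; case: b; case: (g _).
Qed.

Lemma card_star P D c :
  uniq D -> c \notin D -> {in D, forall x g, P (flip x c g) = P g} ->
  #|[set g | P g && all (fun x => g (x, c)) D]| * 2 ^ size D = #|[set g | P g]|.
Proof.
elim: D => [_ _ _|x D IHD /= /andP[xD uD]].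
  by rewrite muln1; apply: eq_card => g; rewrite !inE andbT.
rewrite inE negb_or => /andP[cx cD] Pflip.
rewrite -IHD // => [|y yD]; last by apply: Pflip; rewrite inE yD orbT.
rewrite expnS mulnA; congr (_ * _).
(* The conditions on the other edges at [c] do not involve the edge [xc], so prescribing it halves
   the count. *)
rewrite -[RHS](card_edge_half _ x c true) => [|g].
  congr (_ * _); apply: eq_card => g; rewrite !inE eqb_id.
  by rewrite andbAC -andbA.
rewrite Pflip ?mem_head //; congr (_ && _); apply: eq_in_all => y yD.
apply: flip_out; apply/orP; left; rewrite !inE negb_or.
by rewrite (memPn xD) // (memPn cD).
Qed.

(** The exponent counts the prescribed pairs: [cd] itself and one pair from each element of [D] to
    each of [c] and [d]. They are imposed in the order [cd], star at [c], star at [d]. *)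
Lemma card_nonadjacent_common_nbrs P D c d :
  uniq [:: c, d & D] ->
  (forall x g, x != c -> P (flip x c g) = P g) ->
  (forall x g, x != d -> P (flip x d g) = P g) ->
  #|[set g | P g && nonadjacent_common_nbrs g D c d]| * 2 ^ (size D).*2.+1
    = #|[set g | P g]|.
Proof.
rewrite /= inE negb_or => /and3P[/andP[cd cD] dD uD] Pc Pd.
rewrite -(card_edge_half P c d false) => [|g]; last exact: Pd.
rewrite expnSr -addnn expnD !mulnA; congr (_ * _).
pose P1 g := P g && (g (c, d) == false).
pose P2 g := P1 g && all (fun x => g (x, c)) D.
rewrite -/P1 -(card_star P1 D c) // => [|x xD g].
  congr (_ * _); rewrite -(card_star P2 D d) // => [|x xD g].
    congr (_ * _); apply: eq_card => g.
    by rewrite !inE /nonadjacent_common_nbrs cd /P2 /P1 eqbF_neg -!andbA.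
  rewrite /P2 /P1 Pd ?(memPn dD) // flip_out; last first.
    by rewrite !inE negb_or cd eq_sym (memPn cD).
  congr (_ && _); apply: eq_in_all => y yD; apply: flip_out.
  by rewrite !inE !negb_or cd (memPn dD y yD) [c == x]eq_sym (memPn cD x xD) orbT.
rewrite /P1 Pc ?(memPn cD) // flip_out //; apply/orP; right.
by rewrite !inE negb_or [d == x]eq_sym (memPn dD x xD) eq_sym.
Qed.

Definition no_pair_among D (ps : seq ('I_n * 'I_n)) g :=
  simpleg g && all (fun p => ~~ nonadjacent_common_nbrs g D p.1 p.2) ps.

Lemma no_pair_among_flip D ps x c g :
  x != c -> c \notin D ++ unzip1 ps ++ unzip2 ps ->
  no_pair_among D ps (flip x c g) = no_pair_among D ps g.
Proof.
rewrite !mem_cat !negb_or => xc /and3P[cD c1 c2].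
rewrite /no_pair_among simpleg_flip //; congr (_ && _).
apply: eq_in_all => -[d e] deps /=; congr (~~ _).
have dc : d != c by apply: (memPn c1); apply: (map_f fst deps).
have ec : e != c by apply: (memPn c2); apply: (map_f snd deps).
rewrite /nonadjacent_common_nbrs flip_avoid //.
congr [&& _, _, _ & _]; apply: eq_in_all => y yD;
  by rewrite flip_avoid // (memPn cD).
Qed.

(** Each new pair is disjoint from [D] and from the earlier pairs, so its success has conditional
    probability [1/M] and its failure multiplies the count by [(M-1)/M]. Denominators are cleared to
    stay in the natural numbers. *)
Lemma card_no_pair_among D ps (M := 2 ^ (size D).*2.+1) :
  uniq (D ++ unzip1 ps ++ unzip2 ps) ->
  #|[set g | no_pair_among D ps g]| * M ^ size ps
    = M.-1 ^ size ps * #|simple_graphs n|.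
Proof.
elim: ps => [_|[c d] ps IHps].
  rewrite muln1 mul1n; apply: eq_card => g.
  by rewrite !inE /no_pair_among andbT.
have cdE : perm_eq (D ++ (c :: unzip1 ps) ++ d :: unzip2 ps)
             [:: c, d & D ++ unzip1 ps ++ unzip2 ps].
  apply/permP => a; rewrite /= !count_cat /= !count_cat.
  by rewrite (addnCA (count a (unzip1 ps))) !(addnCA (count a D)).
rewrite /= (perm_uniq cdE) /= inE negb_or => /and3P[/andP[cd cN] dN uN].
have uD : uniq [:: c, d & D].
  move: cN dN uN; rewrite !mem_cat !negb_or cat_uniq /= inE negb_or cd.
  by move=> /andP[-> _] /andP[-> _] /andP[-> _].
pose bad := [set g | no_pair_among D ps g].
pose hit := [set g | no_pair_among D ps g && nonadjacent_common_nbrs g D c d].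
have hitE : #|hit| * M = #|bad|.
  by apply: card_nonadjacent_common_nbrs => // x g xc; apply: no_pair_among_flip.
have missE : #|[set g | no_pair_among D ((c, d) :: ps) g]| = #|bad| - #|hit|.
  rewrite -(cardsID hit bad) (setIidPr _) ?addKn.
    apply: eq_card => g; rewrite !inE /no_pair_among /= andbCA.
    by case: (simpleg g && _); rewrite ?andbF ?andbT.
  by apply/subsetP => g; rewrite !inE => /andP[].
rewrite missE !expnS mulnA mulnBl hitE -[X in _ - X]muln1 -mulnBr subn1.
by rewrite mulnAC IHps // mulnC mulnA.
Qed.

Lemma card_no_common_nbrs D j (M := 2 ^ (size D).*2.+1) :
  uniq D -> size D + j.*2 <= n ->
  #|[set g : graph n | simpleg g &&
      ~~ [exists c, exists d, nonadjacent_common_nbrs g D c d]]| * M ^ j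
    <= M.-1 ^ j * #|simple_graphs n|.
Proof.
move=> uD Dj; pose rest := enum [predC D].
have sz_rest : j.*2 <= size rest.
  by rewrite -cardE -(leq_add2l #|D|) cardC card_ord (card_uniqP uD).
have jj : j <= size (drop j rest).
  by rewrite size_drop leq_subRL ?addnn // (leq_trans _ sz_rest) // -addnn leq_addr.
have j1 : size (take j rest) = j.
  by rewrite size_takel // (leq_trans _ sz_rest) // -addnn leq_addr.
have j2 : size (take j (drop j rest)) = j by rewrite size_takel.
(* Two consecutive blocks of length [j] outside [D] are matched entry by entry, giving [j] disjoint
   pairs. *)
pose ps := zip (take j rest) (take j (drop j rest)).
have szps : size ps = j by rewrite size_zip j1 j2 minnn.
rewrite -[in leqRHS]szps -card_no_pair_among.
  rewrite szps leq_mul2r; apply/orP; right; apply: subset_leq_card.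
  apply/subsetP => g; rewrite !inE => /andP[gs /existsPn gN].
  rewrite /no_pair_among gs; apply/allP => p _.
  by have /existsPn := gN p.1; apply.
rewrite /ps unzip1_zip ?j1 ?j2 // unzip2_zip ?j1 ?j2 //.
rewrite -takeD cat_uniq uD take_uniq ?enum_uniq //= andbT.
by apply/hasPn => x /mem_take; rewrite mem_enum.
Qed.

End EdgeFlips.

(** * Decay estimate and union bound over triples *)

Section Asymptotics.

Local Open Scope nat_scope.

(** A weak Bernoulli inequality. For positive [m] it bounds [(y/(y+1))^m] by [y/m], and the fourth
    power of this bound suffices against cubically many triples. *)
Lemma expn_bernoulli y m : m * y ^ m <= y * y.+1 ^ m.
Proof.
elim: m => // m IHm.
have yS : y ^ m <= y.+1 ^ m by case: m {IHm} => // m; rewrite leq_exp2r.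
rewrite [y ^ m.+1]expnS mulnCA [m.+1 * _]mulSn addnC mulnDr.
rewrite expnS mulSn mulnDr addnC.
by apply: leq_add; rewrite leq_mul2l ?yS ?IHm orbT.
Qed.

(** With [4m] pairs a triple fails with probability at most [(127/128)^(4m)], hence at most
    [(127/m)^4]. Summing over at most [(km)^3] triples leaves [k^3 * 127^4 / m]. The bound
    [8 * m + 3] makes room for the triple and the pairs. *)
Lemma card_simple_not_inT k : exists C : nat, forall n m (S : {set graph n}),
  (forall g : graph n, simpleg g -> inT g -> g \in S) ->
  0 < m -> 8 * m + 3 <= n <= k * m ->
  m * #|simple_graphs n :\: S| <= C * #|simple_graphs n|.
Proof.
pose y := (2 ^ 7).-1; have yE : 2 ^ 7 = y.+1 by [].
move: y yE => y yE; exists (k ^ 3 * y ^ 4) => n m S ST m_gt0 /andP[n_ge n_le].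
(* [Bad t] is empty when [t] has a repetition, so the union can run over all [n^3] triples. *)
pose Bad (t : 'I_n * 'I_n * 'I_n) :=
  let D := [:: t.1.1; t.1.2; t.2] in
  [set g : graph n | uniq D & simpleg g &&
      ~~ [exists c, exists d, nonadjacent_common_nbrs g D c d]].
have n_gt2 : 2 < n by apply: leq_trans n_ge; rewrite leq_addl.
have cover : simple_graphs n :\: S \subset \bigcup_t Bad t.
  apply/subsetP => g; rewrite !inE => /andP[gS gs].
  apply: contraR gS => gbad; apply: ST => //.
  apply: inT_of_common_nbrs => // a b v abv.
  have : g \notin Bad (a, b, v).
    by apply: contra gbad => gB; apply/bigcupP; exists (a, b, v).
  by rewrite inE abv gs /= negbK => /existsP[c /existsP[d cd]]; exists c, d.
have badE t : m ^ 4 * #|Bad t| <= y ^ 4 * #|simple_graphs n|.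
  rewrite /Bad; set D := [:: t.1.1; _; _].
  have [uD|_] := boolP (uniq D); last first.
    by rewrite eq_card0 ?muln0 // => g; rewrite inE.
  have := @card_no_common_nbrs n D (m * 4) uD.
  rewrite -muln2 -mulnA mulnC addnC n_ge => /(_ isT).
  rewrite [(size _).*2.+1]/= yE /=.
  set B := #|_| => leB.
  have y_gt0 : 0 < y.+1 ^ (m * 4) by rewrite expn_gt0.
  rewrite -(leq_pmul2r y_gt0) -mulnA.
  apply: leq_trans (leq_mul (leqnn (m ^ 4)) leB) _.
  rewrite mulnA [leqRHS]mulnAC leq_mul2r; apply/orP; right.
  by rewrite !expnM -!expnMn leq_exp2r // expn_bernoulli.
rewrite -(leq_pmul2l (_ : 0 < m ^ 3)) ?expn_gt0 ?m_gt0 //.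
have unionB : #|simple_graphs n :\: S| <= \sum_t #|Bad t|.
  apply: leq_trans (subset_leq_card cover) _.
  elim/big_rec2: _ => [|t j X _ IH]; rewrite ?cards0 //.
  by rewrite (leq_trans (leq_card_setU _ _)) ?leq_add2l.
rewrite mulnA -expnSr (leq_trans (leq_mul (leqnn _) unionB)) // big_distrr /=.
apply: leq_trans (leq_sum _ (fun t _ => badE t)) _.
rewrite sum_nat_const !card_prod card_ord mulnn -expnSr.
rewrite -[k ^ 3 * _ * _]mulnA [leqRHS]mulnA -expnMn.
by rewrite leq_mul // mulnC leq_exp2r.
Qed.

End Asymptotics.

Theorem theorem3p10 :
  forall eps : rat, 0 < eps ->
  exists N : nat, forall n : nat, (N <= n)%N ->
  forall S : {set graph n},
    (forall g : graph n, g \in S <-> (simpleg g /\ inT g)) ->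
    1 - eps <= (#|S|%:R / #|simple_graphs n|%:R : rat).
Proof.
(* The constant 18 comes from [m = (n - 3) %/ 8]: then [n] is at most [8m + 10], and [m] is
   positive. *)
move=> eps eps_gt0; have [C HC] := card_simple_not_inT 18.
have [m0 m0_gt0 Cm0] : exists2 m0, (0 < m0)%N & C%:R / eps <= m0%:R.
  exists (Num.bound (C%:R / eps)).+1 => //; apply: ltW.
  apply: lt_trans (archi_boundP _) _; first by rewrite divr_ge0 ?ler0n ?ltW.
  by rewrite ltr_nat.
exists (8 * m0 + 3)%N => n n_ge S SE.
pose m := ((n - 3) %/ 8)%N.
have m0m : (m0 <= m)%N.
  rewrite -[m0](mulKn _ (isT : 0 < 8)%N) leq_div2r //.
  by rewrite -[X in (X <= _)%N](addnK 3) leq_sub2r.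
have m_gt0 : (0 < m)%N by apply: leq_trans m0m.
have nE : (n = m * 8 + (n - 3) %% 8 + 3)%N.
  by rewrite -divn_eq subnK // (leq_trans _ n_ge) ?leq_addl.
have n_bnd : (8 * m + 3 <= n <= 18 * m)%N.
  have := ltn_pmod (n - 3) (isT : 0 < 8)%N; move: nE; set r := modn _ _.
  move=> -> r8; rewrite mulnC leq_add2r leq_addr /=.
  apply: (@leq_trans (m * 8 + 10)).
    by rewrite -addnA leq_add2l (leq_add (_ : r <= 7)%N (leqnn 3)).
  by rewrite (_ : 18 = 8 + 10)%N // mulnDl mulnC leq_add2l leq_pmulr.
have S_sub : S \subset simple_graphs n.
  by apply/subsetP => g /SE[gs _]; rewrite inE.
have := HC n m S (fun g gs gT => (SE g).2 (conj gs gT)) m_gt0 n_bnd.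
have T_gt0 : (0 < #|simple_graphs n|)%N.
  apply/card_gt0P; exists [ffun=> false]; rewrite inE; apply/andP; split.
    by apply/forallP => x; rewrite ffunE.
  by apply/forallP => x; apply/forallP => y; rewrite !ffunE.
rewrite cardsD (setIidPr S_sub) => leC.
have T_gt0R : 0 < #|simple_graphs n|%:R :> rat by rewrite ltr0n.
(* The goal becomes that the graphs outside [S] number at most [eps] times all simple graphs. This
   follows from [leC], as [C / eps] is at most [m]. *)
rewrite ler_pdivlMr // mulrBl mul1r lerBlDr -lerBlDl.
rewrite -natrB ?subset_leq_card //.
have mR : 0 < m%:R :> rat by rewrite ltr0n.
rewrite -(ler_pM2l mR) -natrM.
apply: le_trans (_ : (C * #|simple_graphs n|)%:R <= _); first by rewrite ler_nat.
rewrite natrM mulrA ler_pM2r // -ler_pdivrMr //.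
by rewrite (le_trans Cm0) // ler_nat.
Qed.
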